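(* Let $M=S^2$ be the unit sphere with its area form $\mu=\omega=d\varphi\wedge dz$, canonical metric $g_0$ and complex structure $J_0$, and let $g=g_0(1+P)(1-P)^{-1}$ be an associated metric, where $P$ is given by a complex function $p$. Let $A,B\in\mathrm{End}_{SJ_0}(TM)$ be operators given by functions $\alpha$ and $\beta$, and let $h_A,h_B$ be the corresponding elements of the tangent space $T_g\mathcal{AM}(S^2)$. Then the sectional curvature $K_\sigma$ of $\mathcal{AM}(S^2)$ in the plane section $\sigma$ generated by $h_A,h_B$ is $$K_\sigma=-\frac12\,\frac{\displaystyle\int_M\frac{(\mathrm{Im}(\alpha\overline\beta))^2}{(1-|p|^2)^4}d\mu}{\displaystyle\int_M\frac{|\alpha|^2}{(1-|p|^2)^2}d\mu\ \int_M\frac{|\beta|^2}{(1-|p|^2)^2}d\mu-\left(\int_M\frac{\mathrm{Re}(\overline\alpha\beta)}{(1-|p|^2)^2}d\mu\right)^2}.$$ In particular: 1) If $\alpha$ and $\beta$ are simultaneously either real or pure imaginary, then $K_\sigma=0$. 2) If one of $\alpha,\beta$ is real and the other is pure imaginary, then $$K_\sigma=-\frac12\,\frac{\displaystyle\int_M\frac{(\mathrm{Im}(\alpha\beta))^2}{(1-|p|^2)^4}d\mu}{\displaystyle\int_M\frac{|\alpha|^2}{(1-|p|^2)^2}d\mu\ \int_M\frac{|\beta|^2}{(1-|p|^2)^2}d\mu}.$$ 3) The holomorphic sectional curvature is bounded from above by a negative constant: $$K(h_A,\mathbf Jh_A)\le-\frac1{8\pi}.$$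
   Context: On $S^2\subset\mathbb R^3$ use coordinates $(\varphi,z)\in(0,2\pi)\times(-1,1)$ ($\varphi$ the longitude, $z$ the height). Then $g_0=(1-z^2)d\varphi^2+\frac1{1-z^2}dz^2$; with the orthonormal frame $e_1=\frac1{\sqrt{1-z^2}}\partial_\varphi$, $e_2=\sqrt{1-z^2}\,\partial_z$ one has $J_0e_1=e_2$, $J_0e_2=-e_1$, and the complex frame is $\partial=\frac12(e_1-ie_2)$, $\overline\partial=\frac12(e_1+ie_2)$. $\mathcal{AM}(S^2)$ is the space of smooth associated metrics $g(X,Y)=\omega(X,JY)$, where $J$ is an almost complex structure with $\omega(JX,JY)=\omega(X,Y)$ and $\omega(X,JX)>0$ for $X\neq0$; it carries the weak Riemannian structure $(a,b)_g=\int_M\mathrm{tr}(g^{-1}ag^{-1}b)\,d\mu$ and the complex structure $(\mathbf Ja)(X,Y)=a(X,JY)$ on $T_g\mathcal{AM}$, the space of smooth symmetric 2-forms $a$ with $a(JX,JY)=-a(X,Y)$. $\mathrm{End}_{SJ_0}(TM)$ is the space of smooth $g_0$-symmetric endomorphisms of $TM$ anticommuting with $J_0$; such an $A$ is given by a complex function $\alpha(\varphi,z)$ via $A\partial=\alpha\overline\partial$, $A\overline\partial=\overline\alpha\,\partial$ (similarly $B$ by $\beta$, $P$ by $p$). Every associated metric is uniquely $g(X,Y)=g_0(X,(1+P)(1-P)^{-1}Y)$ with $P\in\mathrm{End}_{SJ_0}(TM)$, $|p|<1$ (i.e. $1-P^2>0$), and $h_A=2g_0(1-P)^{-1}A(1-P)^{-1}$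 is the image of $A$ under the differential at $P$ of this parametrization. The sectional curvature of $\mathcal{AM}$ in the plane spanned by linearly independent $a,b\in T_g\mathcal{AM}$ is $\frac{1}{4\|a\wedge b\|^2}\int_M\mathrm{tr}([g^{-1}a,g^{-1}b]^2)\,d\mu$ with $\|a\wedge b\|^2=(a,a)_g(b,b)_g-(a,b)_g^2$. *)

(* Defs.v *)
From HB Require Import structures.
From mathcomp Require Import all_boot all_order all_algebra.
From mathcomp Require Import all_classical all_reals all_analysis.
From mathcomp Require Import complex.
Set Implicit Arguments.
Unset Strict Implicit.
Unset Printing Implicit Defensive.
Import Order.TTheory GRing.Theory Num.Theory.
Import numFieldNormedType.Exports.
Import ComplexField.Normc.

Local Open Scope classical_set_scope.
Local Open Scope ring_scope.

(* S^2 is treated as a submanifold of R^3.  T_xS^2 is the orthogonal complement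
   of x.  A field of endomorphisms (or of bilinear forms) on S^2 is a
   matrix-valued map T on R^3, of which only the values on the sphere matter;
   T x is extended by zero on the normal line spanned by x, so that identities
   and traces on T_xS^2 are identities and traces of 3 x 3 matrices. *)

Section Sphere.
Variable R : realType.

Definition vec3 (a b c : R) : 'cV[R]_3 := \col_(i < 3) [:: a; b; c]`_i.

Definition dot (u v : 'cV[R]_3) : R := \sum_(i < 3) u i 0 * v i 0.

Definition cross (u v : 'cV[R]_3) : 'cV[R]_3 :=
  let u0 := u 0 0 in let u1 := u 1 0 in let u2 := u 2%:R 0 in
  let v0 := v 0 0 in let v1 := v 1 0 in let v2 := v 2%:R 0 in
  vec3 (u1 * v2 - u2 * v1) (u2 * v0 - u0 * v2) (u0 * v1 - u1 * v0).

Definition sphere : set 'cV[R]_3 := [set x | dot x x = 1].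

Definition tangent (x : 'cV[R]_3) : set 'cV[R]_3 := [set u | dot x u = 0].

(* The area form det(x, u, v). *)
Definition omega (x u v : 'cV[R]_3) : R := dot x (cross u v).

(* The matrix of v |-> x * v (cross product). *)
Definition J0 (x : 'cV[R]_3) : 'M[R]_3 :=
  \matrix_(i, j) cross x (delta_mx j 0) i 0.

(* The canonical metric, i.e. the scalar product of R^3 on T_xS^2 extended by
   zero; as an endomorphism it is the orthogonal projection onto T_xS^2. *)
Definition g0 (x : 'cV[R]_3) : 'M[R]_3 := 1%:M - x *m x^T.

Definition tfield := 'cV[R]_3 -> 'M[R]_3.

Definition bil (a : 'M[R]_3) (u v : 'cV[R]_3) : R := dot u (a *m v).

Fixpoint Ck (k : nat) (U : set 'cV[R]_3) (f : 'cV[R]_3 -> R) : Prop :=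
  (forall x, U x -> {for x, continuous f}) /\
  if k is k'.+1 then
    forall i : 'I_3, (forall x, U x -> derivable f x (delta_mx i 0)) /\
                     Ck k' U ('D_(delta_mx i 0) f)
  else True.

Definition smooth_on (U : set 'cV[R]_3) (f : 'cV[R]_3 -> R) : Prop :=
  forall k, Ck k U f.

(* The library norm `|x| on matrices is the sup norm, hence the explicit
   Euclidean norm. *)
Definition radial (x : 'cV[R]_3) : 'cV[R]_3 := (Num.sqrt (dot x x))^-1 *: x.

(* T is smooth on S^2 iff its extension to R^3 \ {0}, constant along rays,
   is smooth. *)
Definition smooth_field (T : tfield) : Prop :=
  forall i j : 'I_3,
    smooth_on [set x | x != 0] (fun x => T (radial x) i j).

Definition tangential (T : tfield) : Prop :=
  forall x, sphere x -> T x *m x = 0 /\ x^T *m T x = 0.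

Definition tensor_field (T : tfield) : Prop := tangential T /\ smooth_field T.

Definition almost_complex (J : tfield) : Prop :=
  tensor_field J /\ forall x, sphere x -> J x *m J x = - g0 x.

(* g lies in AM(S^2) and J is its almost complex structure. *)
Definition associated_metric (g J : tfield) : Prop :=
  [/\ tensor_field g, almost_complex J &
      forall x, sphere x ->
        [/\ forall u v, tangent x u -> tangent x v ->
              omega x (J x *m u) (J x *m v) = omega x u v,
            forall u, tangent x u -> u != 0 -> 0 < omega x u (J x *m u) &
            forall u v, tangent x u -> tangent x v ->
              bil (g x) u v = omega x u (J x *m v)]].

Definition EndSJ0 (A : tfield) : Prop :=
  tensor_field A /\
  forall x, sphere x -> (A x)^T = A x /\ A x *m J0 x = - (J0 x *m A x).

(* 1 - P^2 > 0 on all of S^2, which is |p| < 1 without the restriction to the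
   coordinate domain. *)
Definition subunit (P : tfield) : Prop :=
  forall x u, sphere x -> tangent x u -> u != 0 ->
    0 < dot u ((1%:M - P x *m P x) *m u).

(* On the normal line 1 - P is the identity, so invmx (1 - P) restricts to the
   inverse of 1 - P on T_xS^2. *)
Definition metric_of (P : tfield) : tfield := fun x =>
  g0 x *m ((1%:M + P x) *m invmx (1%:M - P x)).

Definition h_of (P A : tfield) : tfield := fun x =>
  2 *: (g0 x *m (invmx (1%:M - P x) *m A x *m invmx (1%:M - P x))).

Definition bfJ (J a : tfield) : tfield := fun x => a x *m J x.

(* g^{-1} a: g x + x x^T is g x on T_xS^2 and the identity on the normal line. *)
Definition raise (g a : tfield) : tfield := fun x =>
  invmx (g x + x *m x^T) *m a x.

(* The chart q = (phi, z). *)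
Definition chart_dom : set (R * R) := `]0, 2 * pi[ `*` `]-1, 1[.

Definition chart (q : R * R) : 'cV[R]_3 :=
  let r := Num.sqrt (1 - q.2 ^+ 2) in
  vec3 (r * cos q.1) (r * sin q.1) q.2.

(* (1 - z^2)^(-1/2) d/dphi and (1 - z^2)^(1/2) d/dz. *)
Definition e1 (q : R * R) : 'cV[R]_3 := vec3 (- sin q.1) (cos q.1) 0.
Definition e2 (q : R * R) : 'cV[R]_3 :=
  vec3 (- q.2 * cos q.1) (- q.2 * sin q.1) (Num.sqrt (1 - q.2 ^+ 2)).

Definition cplx {m n} (A : 'M[R]_(m, n)) : 'M[R[i]]_(m, n) :=
  map_mx (fun x : R => x%:C%C) A.

Definition del (q : R * R) : 'cV[R[i]]_3 :=
  2^-1 *: (cplx (e1 q) - 'i%C *: cplx (e2 q)).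
Definition delbar (q : R * R) : 'cV[R[i]]_3 :=
  2^-1 *: (cplx (e1 q) + 'i%C *: cplx (e2 q)).

Definition given_by (A : tfield) (alpha : R * R -> R[i]) : Prop :=
  forall q, chart_dom q ->
    cplx (A (chart q)) *m del q = alpha q *: delbar q /\
    cplx (A (chart q)) *m delbar q = (alpha q)^*%C *: del q.

(* Integration over M; d mu is dphi dz, and the complement of the chart is a
   null set. *)
Definition intM (F : R * R -> R) : R :=
  Rintegral (lebesgue_measure \x lebesgue_measure)%E chart_dom F.

Definition inner (g a b : tfield) : R :=
  intM (fun q => \tr (raise g a (chart q) *m raise g b (chart q))).

Definition wedge2 (g a b : tfield) : R :=
  inner g a a * inner g b b - inner g a b ^+ 2.

Definition commutator (A B : 'M[R]_3) : 'M[R]_3 := A *m B - B *m A.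

(* The sectional curvature of AM(S^2) at g in the plane spanned by a, b. *)
Definition sectional (g a b : tfield) : R :=
  (4 * wedge2 g a b)^-1 *
  intM (fun q =>
    let C := commutator (raise g a (chart q)) (raise g b (chart q)) in
    \tr (C *m C)).

Definition lin_indep (a b : tfield) : Prop :=
  forall s t : R, (forall x, sphere x -> s *: a x + t *: b x = 0) ->
    s = 0 /\ t = 0.

Definition real_on_dom (f : R * R -> R[i]) : Prop :=
  forall q, chart_dom q -> complex.Im (f q) = 0.

Definition imag_on_dom (f : R * R -> R[i]) : Prop :=
  forall q, chart_dom q -> complex.Re (f q) = 0.

End Sphere.

(* Main.v *)
Require Import Defs.
From HB Require Import structures.
From mathcomp Require Import all_boot all_order all_algebra.
From mathcomp Require Import all_classical all_reals all_analysis.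
From mathcomp Require Import measurable_realfun complex ring lra.
Set Implicit Arguments.
Unset Strict Implicit.
Unset Printing Implicit Defensive.
Import Order.TTheory GRing.Theory Num.Theory.
Import numFieldNormedType.Exports.
Import ComplexField.Normc.
Local Open Scope classical_set_scope.
Local Open Scope ring_scope.

(** Everything reduces to algebra at one point of the sphere, followed by an
    elementary argument about integrals over the chart.

    At a point, choose an oriented orthonormal basis of the tangent plane.  A
    g0-symmetric endomorphism anticommuting with J0 becomes a symmetric
    traceless 2 x 2 matrix [symtf a b], which stands for the complex number
    a - i b, and two of them multiply as
      A B = Re(conj(alpha) beta) - Im(alpha conj(beta)) J0
    ([symtf_mul]).  In particular P^2 = |p|^2, so with d = 1 - |p|^2 the inverse
    of 1 - P is (1 + P) / d and g^-1 h_A = (2 / d^2) (1 - P) A (1 + P)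
    ([raise_h_of_adapted]).  As (1 + P)(1 - P) = d is a scalar, products of such
    twisted operators are twisted products ([twisted_product]), and both traces
    that occur in the curvature drop out:
      tr (g^-1 h_A g^-1 h_B) = 8 Re(conj(alpha) beta) / d^2,
      tr ([g^-1 h_A, g^-1 h_B]^2) = - 128 Im(alpha conj(beta))^2 / d^4
    ([mxtrace_raise], [mxtrace_commutator]).  The general formula is the
    quotient of the resulting integrals, and its two specializations come from
    the vanishing of Im(alpha conj(beta)), respectively of Re(conj(alpha) beta).

    For the holomorphic curvature, compatibility of g with J forces J = J0 g,
    and then J h_A = h_B with B = A J0, that is beta = i alpha
    ([h_of_mulJ0]).  So |alpha| = |beta| and alpha, beta are orthogonal
    pointwise, and with w = |alpha|^2 / d^2 the curvature is
      - (1/2) (integral of w^2) / (integral of w)^2.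
    Cauchy-Schwarz on a surface of area 4 pi ([intM_sqr_le]) bounds this by
    - 1 / (8 pi), once the integral of w is known not to vanish: w is
    continuous, and it is positive at some point of the closed coordinate
    rectangle, which covers the whole sphere ([chart_surj], [intM_gt0]).

    Pulling constants out of integrals needs integrability.  It is free because
    all integrands are restrictions to the chart of functions that are
    continuous on the whole (phi, z)-plane ([continuous_weight],
    [integrable_chart]). *)

(** * Symmetric traceless matrices of the plane *)

Section Planar.
Variable R : realType.

Ltac by_entries2 :=
  apply/matrixP => -[[|[|?]] ?] [[|[|?]] ?] //;
  rewrite ?(mxE, big_ord_recl, big_ord0) /= ?(mxE, big_ord_recl, big_ord0) /=;
  rewrite ?mulr0n ?mulr1n.

(** The matrix, in an oriented orthonormal basis of a tangent plane, of the
    operator A with A del = (a - i b) delbar. *)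
Definition symtf (a b : R) : 'M[R]_2 :=
  \matrix_(i, j) if i == j then (if i == 0 then a else - a) else b.

(** The matrix of J0 in an oriented orthonormal basis. *)
Definition quarter_turn : 'M[R]_2 :=
  \matrix_(i, j) if i == j then 0 else (if i == 0 then -1 else 1).

(** With alpha = a - i b and beta = c - i d the two coefficients are the real
    part and, up to sign, the imaginary part of alpha * conj beta. *)
Lemma symtf_mul a b c d : symtf a b *m symtf c d =
  (a * c + b * d)%:M + (b * c - a * d) *: quarter_turn.
Proof. by by_entries2; ring. Qed.

Lemma quarter_turn_sqr : quarter_turn *m quarter_turn = - 1%:M.
Proof. by by_entries2; ring. Qed.

Lemma symtf_comm a b c d :
  symtf a b *m symtf c d - symtf c d *m symtf a b =
  (2 * (b * c - a * d)) *: quarter_turn.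
Proof.
rewrite !symtf_mul (mulrC c) (mulrC d) [c * b]mulrC [d * a]mulrC.
rewrite opprD addrACA subrr add0r -scalerBl.
by congr (_ *: _); ring.
Qed.

Lemma symtf_sqr a b : symtf a b *m symtf a b = (a ^+ 2 + b ^+ 2)%:M :> 'M[R]_2.
Proof. by rewrite symtf_mul [b * a]mulrC subrr scale0r addr0. Qed.

Lemma symtf_of_anticomm (X : 'M[R]_2) :
  X^T = X -> X *m quarter_turn = - (quarter_turn *m X) ->
  X = symtf (X 0 0) (X 0 1).
Proof.
move=> /matrixP sX /matrixP aX.
have := sX 1 0; rewrite mxE => s10.
have := aX 0 1; rewrite !(mxE, big_ord_recl, big_ord0) /=.
have -> : lift ord0 ord0 = 1 :> 'I_2 by apply/val_inj.
move=> a01.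
apply/matrixP => -[[|[|i]] Hi] [[|[|j]] Hj] //; rewrite mxE /=.
- by congr (X _ _); apply/val_inj.
- by congr (X _ _); apply/val_inj.
- by rewrite s10; congr (X _ _); apply/val_inj.
- have -> : X (Ordinal Hi) (Ordinal Hj) = X 1 1 by congr (X _ _); apply/val_inj.
  lra.
Qed.

(** P^2 is a scalar for P symmetric and traceless, which makes 1 + P and 1 - P
    inverse to each other up to a factor. *)
Lemma sqr_scalar_factors (P : 'M[R]_2) n : P *m P = n%:M ->
  (1%:M - P) *m (1%:M + P) = (1 - n)%:M /\
  (1%:M + P) *m (1%:M - P) = (1 - n)%:M.
Proof.
move=> PP; rewrite !mulmxDr !mulmxDl !mulmxN !mulNmx !mulmx1 !mul1mx PP.
by rewrite addrA subrK addrA addrK raddfB.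
Qed.

(** Up to a scalar, (1 - P) A (1 + P) is a conjugate of A.  Hence traces and
    commutators of twisted operators reduce to those of the operators. *)
Lemma twisted_product (P A B : 'M[R]_2) n : P *m P = n%:M ->
  ((1%:M - P) *m A *m (1%:M + P)) *m ((1%:M - P) *m B *m (1%:M + P)) =
  (1 - n) *: ((1%:M - P) *m (A *m B) *m (1%:M + P)).
Proof.
move=> /sqr_scalar_factors[_ E].
rewrite !mulmxA -[_ *m (1%:M + P) *m (1%:M - P)]mulmxA E mul_mx_scalar.
by rewrite -!scalemxAl.
Qed.

Lemma mxtrace_twisted (P A : 'M[R]_2) n : P *m P = n%:M ->
  \tr ((1%:M - P) *m A *m (1%:M + P)) = (1 - n) * \tr A.
Proof.
move=> /sqr_scalar_factors[_ E].
by rewrite mxtrace_mulC mulmxA E mul_scalar_mx mxtraceZ.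
Qed.

End Planar.

(** * Coordinates of three-space *)

Section Coordinates.
Variable R : realType.
Implicit Types (x u v : 'cV[R]_3).

Lemma sum_I3 (S : nmodType) (f : 'I_3 -> S) :
  \sum_(i < 3) f i = f 0 + f 1 + f 2%:R.
Proof.
rewrite !big_ord_recl big_ord0 addr0 addrA.
by congr (_ + _ + _); congr f; apply/val_inj.
Qed.

Lemma all_I3 (Q : 'I_3 -> Prop) : Q 0 -> Q 1 -> Q 2%:R -> forall i, Q i.
Proof.
move=> Q0 Q1 Q2 [[|[|[|//]]] Hi].
- by have -> : Ordinal Hi = 0 by apply/val_inj.
- by have -> : Ordinal Hi = 1 by apply/val_inj.
- by have -> : Ordinal Hi = 2%:R by apply/val_inj.
Qed.

Lemma J0_mul x v : J0 x *m v = cross x v.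
Proof.
apply/matrixP => i j; rewrite !ord1 mxE sum_I3; move: i.
by apply: all_I3; rewrite !mxE /= ?mxE /= ?mulr0n ?mulr1n; ring.
Qed.

Lemma J0_anti x : (J0 x)^T = - J0 x.
Proof.
apply/matrixP; apply: all_I3; apply: all_I3;
 by rewrite !mxE /= ?mxE /= ?mulr0n ?mulr1n; ring.
Qed.

Lemma dotE u v : dot u v = (u^T *m v) 0 0.
Proof. by rewrite mxE; apply: eq_bigr => i _; rewrite mxE. Qed.

Lemma J0_tangential x : J0 x *m x = 0 /\ x^T *m J0 x = 0.
Proof.
have J0x : J0 x *m x = 0.
  rewrite J0_mul; apply/matrixP => i j; rewrite ord1; move: i.
  by apply: all_I3; rewrite !mxE /=; ring.
split=> //; apply: trmx_inj.
by rewrite trmx_mul J0_anti trmxK mulNmx J0x oppr0 trmx0.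
Qed.

End Coordinates.

(** * Adapted frames: from 3 x 3 to 2 x 2 matrices *)

Section Frames.
Variable R : realType.
Implicit Types (x : 'cV[R]_3) (U : 'M[R]_(3, 2)).

(** The columns of U are an orthonormal basis of the tangent plane at x,
    oriented so that J0 takes the first one to the second one. *)
Definition frame x U : Prop :=
  [/\ x^T *m x = 1%:M, x^T *m U = 0, U^T *m U = 1%:M,
      U *m U^T = g0 x & U^T *m J0 x *m U = quarter_turn R].

(** The operator that multiplies by s on the normal line and has matrix X on the
    tangent plane.  Fields of endomorphisms vanish on the normal line (s = 0),
    whereas the operators to be inverted are the identity there (s = 1). *)
Definition adapted x U (s : R) (X : 'M[R]_2) : 'M[R]_3 :=
  s *: (x *m x^T) + U *m X *m U^T.

(** The conditions of [EndSJ0] at a single point.  Smoothness is left out so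
    that the pointwise algebra also applies to A J0. *)
Definition symm_anticomm x (M : 'M[R]_3) : Prop :=
  [/\ M *m x = 0, x^T *m M = 0, M^T = M & M *m J0 x = - (J0 x *m M)].

Lemma adapted_tangential x U (M : 'M[R]_3) : frame x U ->
  M *m x = 0 -> x^T *m M = 0 -> M = adapted x U 0 (U^T *m M *m U).
Proof.
move=> [_ _ _ UU _] Mx xM.
rewrite /adapted scale0r add0r !mulmxA UU -2!mulmxA UU /g0.
by rewrite mulmxBr mulmx1 !mulmxA Mx mul0mx subr0 mulmxBl mul1mx -mulmxA xM
           mulmx0 subr0.
Qed.

(** The normal line and the tangent plane are invariant, so the product is taken
    blockwise.  This is what lets the 3 x 3 inverses and traces of the curvature
    formula be computed in the plane. *)
Lemma adaptedM x U s t X Y : frame x U ->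
  adapted x U s X *m adapted x U t Y = adapted x U (s * t) (X *m Y).
Proof.
move=> [xx xU UU _ _].
have Ux : U^T *m x = 0 by rewrite -[U^T *m x]trmxK trmx_mul trmxK xU trmx0.
rewrite /adapted mulmxDl !mulmxDr -!scalemxAl -!scalemxAr scalerA.
rewrite !mulmxA -[x *m x^T *m x]mulmxA xx mulmx1.
rewrite -[x *m x^T *m U]mulmxA xU mulmx0 !mul0mx scaler0 addr0.
rewrite -[U *m X *m U^T *m x]mulmxA Ux mulmx0 mul0mx scaler0 add0r.
by rewrite -[U *m X *m U^T *m U]mulmxA UU mulmx1.
Qed.

Lemma adapted1 x U : frame x U -> adapted x U 1 1%:M = 1%:M.
Proof.
by move=> [_ _ _ UU _]; rewrite /adapted scale1r mulmx1 UU /g0 addrC subrK.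
Qed.

Lemma adaptedD x U s t X Y :
  adapted x U s X + adapted x U t Y = adapted x U (s + t) (X + Y).
Proof. by rewrite /adapted scalerDl mulmxDr mulmxDl addrACA. Qed.

Lemma adaptedZ x U k s X : k *: adapted x U s X = adapted x U (k * s) (k *: X).
Proof. by rewrite /adapted scalerDr scalerA -scalemxAr -scalemxAl. Qed.

Lemma adaptedN x U s X : - adapted x U s X = adapted x U (- s) (- X).
Proof. by rewrite -scaleN1r adaptedZ mulN1r scaleN1r. Qed.

Lemma adapted_normal x U : adapted x U 1 0 = x *m x^T.
Proof. by rewrite /adapted mulmx0 mul0mx addr0 scale1r. Qed.

Lemma invmx_adapted x U X Y : frame x U ->
  X *m Y = 1%:M -> invmx (adapted x U 1 X) = adapted x U 1 Y.
Proof.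
move=> F XY; have inv : adapted x U 1 X *m adapted x U 1 Y = 1%:M.
  by rewrite adaptedM // XY mulr1 adapted1.
have [uX _] := mulmx1_unit inv.
by rewrite -[LHS]mulmx1 -inv mulmxA mulVmx // mul1mx.
Qed.

Lemma mxtrace_adapted x U X : frame x U -> \tr (adapted x U 0 X) = \tr X.
Proof.
move=> [_ _ UU _ _].
by rewrite /adapted scale0r add0r mxtrace_mulC mulmxA UU mul1mx.
Qed.

Lemma adapted_g0 x U : frame x U -> g0 x = adapted x U 0 1%:M.
Proof. by move=> [_ _ _ UU _]; rewrite /adapted scale0r add0r mulmx1 UU. Qed.

Lemma adapted_J0 x U : frame x U -> J0 x = adapted x U 0 (quarter_turn R).
Proof.
move=> F; have [_ _ _ _ <-] := F; have [Jx xJ] := J0_tangential x.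
exact: adapted_tangential.
Qed.

Lemma symm_anticomm_adapted x U (M : 'M[R]_3) :
  frame x U -> symm_anticomm x M ->
  exists a b, M = adapted x U 0 (symtf a b).
Proof.
move=> F [Mx xM sM aM].
have ME := adapted_tangential F Mx xM; set X := U^T *m M *m U in ME *.
exists (X 0 0), (X 0 1); rewrite ME; congr adapted; apply: symtf_of_anticomm.
  by rewrite /X !trmx_mul trmxK sM mulmxA.
have JE := adapted_J0 F; have [_ _ UU _ _] := F.
move: aM; rewrite ME JE !adaptedM // adaptedN /adapted.
rewrite !mulr0 oppr0 scale0r !add0r.
move=> /(congr1 (fun Z => U^T *m Z *m U)).
by rewrite !mulmxA !UU !mul1mx -!mulmxA !UU !mulmx1 mulmxA.
Qed.

(** This is Re (conj alpha * beta), written without a frame; unlike the complex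
    functions, it therefore extends continuously across the chart boundary. *)
Definition pairing (A B : 'M[R]_3) : R := 2^-1 * \tr (A *m B).

Lemma pairing_adapted x U a b c d : frame x U ->
  pairing (adapted x U 0 (symtf a b)) (adapted x U 0 (symtf c d)) =
  a * c + b * d.
Proof.
move=> F; rewrite /pairing adaptedM // mulr0 mxtrace_adapted // symtf_mul.
rewrite mxtraceD mxtraceZ mxtrace_scalar /mxtrace !big_ord_recl big_ord0.
by rewrite !mxE /=; field.
Qed.

End Frames.

(** * The two traces of the curvature formula *)

Section Curvature.
Variable R : realType.
Implicit Types (x : 'cV[R]_3) (U : 'M[R]_(3, 2)) (P A B J g : tfield R).

(** 1 - |p|^2. *)
Definition conf_density P x : R := 1 - pairing (P x) (P x).

(** The metric is (1 + P)(1 - P)^-1 and h_A is 2 (1 - P)^-1 A (1 - P)^-1, so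
    g^-1 h_A = 2 (1 + P)^-1 A (1 - P)^-1, where the two inverses are (1 - P) / d
    and (1 + P) / d. *)
Lemma raise_h_of_adapted x U P A g a b p1 p2 :
  frame x U -> P x = adapted x U 0 (symtf p1 p2) ->
  A x = adapted x U 0 (symtf a b) ->
  g x = metric_of P x -> 1 - (p1 ^+ 2 + p2 ^+ 2) != 0 ->
  raise g (h_of P A) x =
  adapted x U 0 ((2 / (1 - (p1 ^+ 2 + p2 ^+ 2)) ^+ 2) *:
     ((1%:M - symtf p1 p2) *m symtf a b *m (1%:M + symtf p1 p2))).
Proof.
move=> F Px Ax gx; have QQ := symtf_sqr p1 p2.
move: (_ + _) (symtf p1 p2) (symtf a b) Px Ax QQ => n Q S Px Ax QQ n1.
have [i1 i2] := sqr_scalar_factors QQ.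
have N : invmx (1%:M - P x) = adapted x U 1 ((1 - n)^-1 *: (1%:M + Q)).
  rewrite -(adapted1 F) Px adaptedN adaptedD subr0; apply: invmx_adapted => //.
  by rewrite -scalemxAr i1 scale_scalar_mx mulVf.
rewrite /raise /h_of gx /metric_of N -(adapted_normal x U) Ax (adapted_g0 F) Px.
rewrite -{1}(adapted1 F) !adaptedD !adaptedM // adaptedD.
rewrite !(mul0r, mulr0, add0r, addr0, mulr1, mul1r).
rewrite !mul1mx adaptedZ mulr0.
have -> : invmx (adapted x U 1 ((1%:M + Q) *m ((1 - n)^-1 *: (1%:M + Q)))) =
   adapted x U 1 ((1%:M - Q) *m ((1 - n)^-1 *: (1%:M - Q))).
  apply: invmx_adapted => //.
  rewrite -!scalemxAr -!scalemxAl mulmxA -[_ *m (1%:M + Q) *m _]mulmxA.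
  rewrite i2 mul_mx_scalar -scalemxAl i2 !scalerA scale_scalar_mx.
  by congr (_%:M); field.
rewrite adaptedM // mulr0; congr adapted.
rewrite -!scalemxAr -!scalemxAl -!scalemxAr -?scalemxAl !mulmxA.
rewrite -[_ *m (1%:M - Q) *m (1%:M + Q)]mulmxA.
rewrite i1 mul_mx_scalar -!scalemxAl !scalerA; congr (_ *: _).
by field.
Qed.

Lemma mxtrace_raise x U P A B g :
  frame x U -> symm_anticomm x (P x) -> symm_anticomm x (A x) ->
  symm_anticomm x (B x) -> g x = metric_of P x -> conf_density P x != 0 ->
  \tr (raise g (h_of P A) x *m raise g (h_of P B) x) =
  8 * (pairing (A x) (B x) / conf_density P x ^+ 2).
Proof.
move=> F sP sA sB gx.
have [p1 [p2 PE]] := symm_anticomm_adapted F sP.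
have [a [b AE]] := symm_anticomm_adapted F sA.
have [c [d BE]] := symm_anticomm_adapted F sB.
rewrite /conf_density PE AE BE !pairing_adapted // -!expr2 => n1.
rewrite ?(raise_h_of_adapted F PE AE gx n1) ?(raise_h_of_adapted F PE BE gx n1).
rewrite adaptedM // mulr0 mxtrace_adapted // -scalemxAl -scalemxAr !mxtraceZ.
have QQ := symtf_sqr p1 p2.
rewrite (twisted_product _ _ QQ) mxtraceZ (mxtrace_twisted _ QQ).
have := @pairing_adapted R x U a b c d F.
rewrite /pairing adaptedM // mulr0 mxtrace_adapted //.
by move=> <-; field.
Qed.

(** The commutator of A and B is a multiple of the quarter turn, whose square is
    - 1; the coefficient is, up to sign, 2 Im (alpha * conj beta), and
    Im (alpha * conj beta)^2 =
    |alpha|^2 |beta|^2 - Re (conj alpha * beta)^2. *)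
Lemma mxtrace_commutator x U P A B g :
  frame x U -> symm_anticomm x (P x) -> symm_anticomm x (A x) ->
  symm_anticomm x (B x) -> g x = metric_of P x -> conf_density P x != 0 ->
  let C := commutator (raise g (h_of P A) x) (raise g (h_of P B) x) in
  \tr (C *m C) = - 128 *
    ((pairing (A x) (A x) * pairing (B x) (B x) - pairing (A x) (B x) ^+ 2)
      / conf_density P x ^+ 4).
Proof.
move=> F sP sA sB gx.
have [p1 [p2 PE]] := symm_anticomm_adapted F sP.
have [a [b AE]] := symm_anticomm_adapted F sA.
have [c [d BE]] := symm_anticomm_adapted F sB.
rewrite /conf_density PE AE BE !pairing_adapted // -!expr2 => n1 /=.
rewrite ?(raise_h_of_adapted F PE AE gx n1) ?(raise_h_of_adapted F PE BE gx n1).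
have QQ := symtf_sqr p1 p2.
rewrite /commutator !adaptedM // adaptedN adaptedD mulr0 subr0.
rewrite -!scalemxAl -!scalemxAr !scalerA !(twisted_product _ _ QQ).
rewrite -scalerBr -scalerBr.
rewrite -mulmxBl -mulmxBr symtf_comm adaptedM // mulr0 mxtrace_adapted //.
rewrite -!scalemxAl -!scalemxAr -!scalemxAl -!scalemxAr -?scalemxAl.
rewrite !scalerA (twisted_product _ _ QQ) !mxtraceZ (mxtrace_twisted _ QQ).
rewrite quarter_turn_sqr.
rewrite raddfN /= mxtrace_scalar.
by field.
Qed.

End Curvature.

(** * The frame of the chart *)

Section ChartFrame.
Variable R : realType.
Implicit Types (q : R * R) (x : 'cV[R]_3).

Definition chart_frame q : 'M[R]_(3, 2) :=
  \matrix_(i, j) if j == 0 then e1 q i 0 else e2 q i 0.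

(** The poles z = 1 and z = - 1 are included: e1 and e2 remain an orthonormal
    basis there, depending on the longitude. *)
Lemma orthonormal_chart q : -1 <= q.2 <= 1 ->
  [/\ dot (chart q) (chart q) = 1,
      dot (chart q) (e1 q) = 0 /\ dot (chart q) (e2 q) = 0,
      [/\ dot (e1 q) (e1 q) = 1, dot (e1 q) (e2 q) = 0 &
          dot (e2 q) (e2 q) = 1],
      cross (chart q) (e1 q) = e2 q & cross (chart q) (e2 q) = - e1 q].
Proof.
case: q => t z /= /andP[z1 z2].
have r2 : Num.sqrt (1 - z ^+ 2) ^+ 2 = 1 - z ^+ 2 by apply: sqr_sqrtr; nra.
have c2 : cos t ^+ 2 = 1 - sin t ^+ 2 by have := cos2Dsin2 t; lra.
rewrite /dot !sum_I3 /chart /e1 /e2 /= !mxE /=.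
move: (Num.sqrt _) (cos t) (sin t) r2 c2 => r c s r2 c2.
split; [ring: r2 c2 | split; ring: r2 c2 | split; ring: r2 c2 | |].
- apply/matrixP => i j; rewrite ord1; move: i.
  by apply: all_I3; rewrite !mxE /= ?mxE /=; ring: r2 c2.
- apply/matrixP => i j; rewrite ord1; move: i.
  by apply: all_I3; rewrite !mxE /= ?mxE /=; ring: r2 c2.
Qed.

Lemma frame_chart q : -1 <= q.2 <= 1 -> frame (chart q) (chart_frame q).
Proof.
move=> /orthonormal_chart[xx [x1 x2] [n11 n12 n22] J1 J2].
have XX : (chart q)^T *m chart q = 1%:M.
  by apply/matrixP => i j; rewrite !ord1 -dotE xx mxE.
have XU : (chart q)^T *m chart_frame q = 0.
  apply/matrixP => i j; rewrite ord1 mxE mxE.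
  transitivity (if j == 0 then dot (chart q) (e1 q) else dot (chart q) (e2 q)).
    by rewrite /dot; case: ifP => j0; apply: eq_bigr => k _; rewrite !mxE j0.
  by case: ifP.
have UU : (chart_frame q)^T *m chart_frame q = 1%:M.
  apply/matrixP => i j; rewrite !mxE.
  transitivity (dot (if i == 0 then e1 q else e2 q)
                    (if j == 0 then e1 q else e2 q)).
    rewrite /dot; apply: eq_bigr => k _; rewrite !mxE.
    by move: (i == 0) (j == 0) => [] []; rewrite !mxE.
  have n21 : dot (e2 q) (e1 q) = 0.
    by rewrite -n12 /dot; apply: eq_bigr => k _; rewrite mulrC.
  by move: i j => [[|[|?]] Hi] [[|[|?]] Hj].
split=> //.
  pose O : 'M[R]_(3, 1 + 2) := row_mx (chart q) (chart_frame q).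
  have : O^T *m O = 1%:M.
    rewrite /O tr_row_mx mul_col_row XX XU UU.
    have -> : (chart_frame q)^T *m chart q = 0.
      by apply: trmx_inj; rewrite trmx_mul trmxK XU trmx0.
    by rewrite -scalar_mx_block.
  move=> /mulmx1C; rewrite /O tr_row_mx mul_row_col /g0 => <-.
  by rewrite addrC addKr.
have -> : (chart_frame q)^T *m J0 (chart q) *m chart_frame q =
   (chart_frame q)^T *m (chart_frame q *m quarter_turn R).
  rewrite -mulmxA; congr (_ *m _).
  apply/matrixP => i j.
  transitivity ((if j == 0 then cross (chart q) (e1 q)
                 else cross (chart q) (e2 q)) i 0).
    rewrite -!J0_mul; case: ifP => j0; rewrite !mxE; apply: eq_bigr => k _;
    by rewrite [chart_frame q k j]mxE j0.
  rewrite J1 J2 !mxE !big_ord_recl big_ord0 !mxE /=.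
  move: j => [[|[|?]] Hj] //=; rewrite ?mxE /=.
    by rewrite mulr0 mulr1 addr0 add0r.
  by rewrite mulrN1 mulr0 !addr0.
by rewrite mulmxA UU mul1mx.
Qed.

Lemma polar (u v : R) : u ^+ 2 + v ^+ 2 = 1 ->
  exists2 t, 0 <= t <= 2 * pi & u = cos t /\ v = sin t.
Proof.
move=> uv; have u1 : -1 <= u <= 1 by apply/andP; split; nra.
have ca : cos (acos u) = u by rewrite acosK.
have sa : sin (acos u) = `|v|.
  by rewrite sin_acos // -uv addrC addKr sqrtr_sqr.
have a0 := acos_ge0 u1; have api := acos_lepi u1.
have [v0|v0] := leP 0 v.
  by exists (acos u); [apply/andP; split; lra|rewrite ca sa ger0_norm].
exists (2 * pi - acos u); first by apply/andP; split; lra.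
rewrite cosB sinB mulr_natl cos2pi sin2pi ca sa ltr0_norm //; split; ring.
Qed.

(** Only the closed rectangle covers the sphere; the open one misses a
    meridian. *)
Lemma chart_surj x : sphere x ->
  exists2 q, [/\ 0 <= q.1 <= 2 * pi & -1 <= q.2 <= 1] & x = chart q.
Proof.
rewrite /sphere /= /dot sum_I3 => xx.
set z := x 2%:R 0 in xx *; set a := x 0 0 in xx *; set b := x 1 0 in xx *.
have z1 : -1 <= z <= 1 by apply/andP; split; nra.
have r2 : Num.sqrt (1 - z ^+ 2) ^+ 2 = 1 - z ^+ 2 by apply: sqr_sqrtr; nra.
have r0 := sqrtr_ge0 (1 - z ^+ 2).
have [t tpi [ac bs]] : exists2 t, 0 <= t <= 2 * pi &
    a = Num.sqrt (1 - z ^+ 2) * cos t /\ b = Num.sqrt (1 - z ^+ 2) * sin t.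
  move: (Num.sqrt _) r2 r0 => r r2 r0.
  have [r00|r1] := eqVneq r 0.
    exists 0; first by rewrite lexx /= mulr_ge0 // pi_ge0.
    by move: r2; rewrite r00 !mul0r => r2; split; nra.
  have [|t tpi [u v]] := @polar (a / r) (b / r).
    rewrite !expr_div_n -mulrDl.
    have -> : a ^+ 2 + b ^+ 2 = r ^+ 2 by lra.
    by rewrite divff // expf_neq0.
  by exists t => //; rewrite -u -v; split; field.
exists (t, z) => //; apply/matrixP => i j; rewrite ord1; move: i.
by apply: all_I3; rewrite mxE /=.
Qed.

Lemma frame_exists x : sphere x -> exists U, frame x U.
Proof.
by move=> /chart_surj[q [_ /frame_chart F] ->]; exists (chart_frame q).
Qed.

End ChartFrame.

(** * The complex structure and the complex functions *)

Section ComplexStructure.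
Variable R : realType.
Implicit Types (x : 'cV[R]_3) (P A g J : tfield R) (q : R * R).

(** The operator given by i alpha when A is given by alpha. *)
Definition mulJ0 A : tfield R := fun x => A x *m J0 x.

Lemma J0_sqr x : sphere x -> J0 x *m J0 x = - g0 x.
Proof.
move=> /frame_exists[U F].
rewrite (adapted_J0 F) (adapted_g0 F) adaptedM // quarter_turn_sqr.
by rewrite adaptedN mulr0 oppr0.
Qed.

Lemma mulmx_g0 m x (M : 'M[R]_(m, 3)) : M *m x = 0 -> M *m g0 x = M.
Proof. by move=> Mx; rewrite /g0 mulmxBr mulmx1 mulmxA Mx mul0mx subr0. Qed.

Lemma g0_mulmx m x (M : 'M[R]_(3, m)) : x^T *m M = 0 -> g0 x *m M = M.
Proof. by move=> xM; rewrite /g0 mulmxBl mul1mx -mulmxA xM mulmx0 subr0. Qed.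

Lemma sphere_trmx_mul x : sphere x -> x^T *m x = 1%:M.
Proof. by move=> xx; apply/matrixP => i j; rewrite !ord1 -dotE xx mxE. Qed.

Lemma tangent_g0 x u : sphere x -> tangent x (g0 x *m u).
Proof.
move=> /sphere_trmx_mul xx.
rewrite /tangent /= dotE /g0 mulmxA mulmxBr mulmx1 mulmxA xx mul1mx subrr.
by rewrite mul0mx mxE.
Qed.

Lemma omegaE x u v : omega x u v = - (u^T *m (J0 x *m v)) 0 0.
Proof.
rewrite J0_mul -dotE /omega /dot !sum_I3 !mxE /=; ring.
Qed.

(** The metric determines J: g(u, v) = omega(u, J v) reads g = - J0 J on the
    tangent plane, and J0 is inverted by - J0. *)
Lemma compatible_J g J x : associated_metric g J -> sphere x ->
  J x = J0 x *m g x.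
Proof.
move=> [[gt _] [[Jt _] _] gJ] xS.
have [_ _ {}gJ] := gJ _ xS; have [gx xg] := gt _ xS; have [Jx xJ] := Jt _ xS.
have [J0x xJ0] := J0_tangential x.
pose M := g x + J0 x *m J x.
have Mx : M *m x = 0 by rewrite mulmxDl gx -mulmxA Jx mulmx0 addr0.
have xM : x^T *m M = 0 by rewrite mulmxDr xg mulmxA xJ0 mul0mx addr0.
have g0T : (g0 x)^T = g0 x.
  by rewrite /g0 linearB /= trmx1 trmx_mul trmxK.
have M0 : M = 0.
  apply/matrixP => i j.
  (* Project the basis vectors of the ambient space to the tangent plane. *)
  have := gJ _ _ (tangent_g0 (delta_mx i 0) xS) (tangent_g0 (delta_mx j 0) xS).
  rewrite /bil dotE omegaE => /eqP; rewrite -addr_eq0 => /eqP.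
  set u := g0 x *m _; set v := g0 x *m _ => uv.
  have : (u^T *m (M *m v)) 0 0 = 0.
    by rewrite mulmxDl mulmxDr -(mulmxA (J0 x)) [LHS]mxE.
  rewrite {uv}/v {}/u (mulmxA M) (mulmx_g0 Mx) trmx_mul g0T.
  rewrite -(mulmxA _ (g0 x)) (mulmxA (g0 x)) (g0_mulmx xM) mulmxA.
  by rewrite trmx_delta -rowE -colE !mxE.
have {M0 Mx xM} gE : g x = - (J0 x *m J x).
  by apply/eqP; rewrite -addr_eq0; apply/eqP.
by rewrite gE mulmxN mulmxA J0_sqr // mulNmx opprK g0_mulmx.
Qed.

Lemma symm_anticomm_mulJ0 A x : symm_anticomm x (A x) ->
  symm_anticomm x (mulJ0 A x).
Proof.
have [Jx xJ] := J0_tangential x.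
move=> [Ax xA sA aA]; rewrite /mulJ0; split.
- by rewrite -mulmxA Jx mulmx0.
- by rewrite mulmxA xA mul0mx.
- by rewrite trmx_mul sA J0_anti mulNmx aA.
- by rewrite mulmxA -mulNmx -aA.
Qed.

(** Multiplication by i preserves lengths and is a rotation by a right angle. *)
Lemma pairing_mulJ0 A x : sphere x -> symm_anticomm x (A x) ->
  pairing (mulJ0 A x) (mulJ0 A x) = pairing (A x) (A x) /\
  pairing (A x) (mulJ0 A x) = 0.
Proof.
move=> xS [Ax xA sA aA]; rewrite /pairing /mulJ0; split.
  congr (_ * _); rewrite mulmxA -(mulmxA (A x)) -[J0 x *m A x]opprK -aA.
  rewrite mulmxN mulNmx !mulmxA -[A x *m A x *m _ *m _]mulmxA J0_sqr //.
  by rewrite mulmxN opprK -mulmxA mulmx_g0.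
have : \tr (A x *m (A x *m J0 x)) = - \tr (A x *m (A x *m J0 x)).
  rewrite {1}mxtrace_mulC -mulmxA -[J0 x *m A x]opprK -aA.
  by rewrite mulmxN raddfN.
by move/eqP; rewrite -addr_eq0 -mulr2n mulrn_eq0 /= => /eqP ->; rewrite mulr0.
Qed.

(** J0 (1 + P) = (1 - P) J0, so J = J0 (1 + P)(1 - P)^-1 on the right of
    (1 - P)^-1 A (1 - P)^-1 only replaces A by A J0. *)
Lemma h_of_mulJ0 g J P A x : associated_metric g J -> sphere x ->
  symm_anticomm x (P x) -> symm_anticomm x (A x) -> g x = metric_of P x ->
  conf_density P x != 0 ->
  bfJ J (h_of P A) x = h_of P (mulJ0 A) x.
Proof.
move=> gJ xS sP [Ax xA sA aA] gx; have [U F] := frame_exists xS.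
have [p1 [p2 PE]] := symm_anticomm_adapted F sP.
have [Jx xJ] := J0_tangential x.
rewrite /conf_density PE pairing_adapted // -!expr2 => n1.
have u1 : 1%:M - P x \in unitmx.
  have QQ := symtf_sqr p1 p2; have [i1 _] := sqr_scalar_factors QQ.
  suff : (1%:M - P x) *m adapted x U 1 ((1 - (p1 ^+ 2 + p2 ^+ 2))^-1 *:
      (1%:M + symtf p1 p2)) = 1%:M.
    by case/mulmx1_unit.
  rewrite PE -{1}(adapted1 F) adaptedN adaptedD subr0 adaptedM // mulr1.
  by rewrite -scalemxAr i1 scale_scalar_mx mulVf // adapted1.
rewrite /bfJ (compatible_J gJ xS) gx /metric_of /h_of /mulJ0 -scalemxAl.
congr (_ *: _); rewrite -!mulmxA; do 3 congr (_ *m _).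
have [_ _ _ aP] := sP.
rewrite (mulmxA (J0 x) (g0 x)) (mulmx_g0 Jx).
have -> : J0 x *m ((1%:M + P x) *m invmx (1%:M - P x)) =
   (1%:M - P x) *m (J0 x *m invmx (1%:M - P x)).
  by rewrite !mulmxA mulmxDr mulmxBl mulmx1 mul1mx aP opprK.
by rewrite mulKmx.
Qed.

Lemma EndSJ0_symm_anticomm A x : EndSJ0 A -> sphere x -> symm_anticomm x (A x).
Proof.
by move=> [[tA _] sA] xS; have [? ?] := tA _ xS; have [? ?] := sA _ xS.
Qed.

(** P^2 is the scalar |p|^2, so a single tangent unit vector suffices to test
    1 - P^2 > 0. *)
Lemma conf_density_gt0 P x : EndSJ0 P -> subunit P -> sphere x ->
  0 < conf_density P x.
Proof.
move=> /EndSJ0_symm_anticomm sP uP xS; have {}sP := sP _ xS.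
have [U F] := frame_exists xS; have [p1 [p2 PE]] := symm_anticomm_adapted F sP.
pose u := U *m (delta_mx 0 0 : 'cV[R]_2).
have [_ xU UU _ _] := F.
have uu : u^T *m u = 1%:M.
  rewrite /u trmx_mul -mulmxA (mulmxA _ U) UU mul1mx trmx_delta mul_delta_mx.
  by apply/matrixP => i j; rewrite !ord1 !mxE.
have tu : tangent x u by rewrite /tangent /= dotE /u mulmxA xU mul0mx mxE.
have u0 : u != 0.
  apply/eqP => u0; move: uu; rewrite u0 mulmx0 => /matrixP/(_ 0 0).
  by rewrite !mxE /= => /esym/eqP; rewrite oner_eq0.
have := uP _ _ xS tu u0.
rewrite dotE mulmxBl mul1mx mulmxBr uu.
have -> : P x *m P x *m u = (p1 ^+ 2 + p2 ^+ 2) *: u.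
  rewrite PE adaptedM // mulr0 symtf_sqr /adapted scale0r add0r /u.
  by rewrite -mulmxA (mulmxA _ U) UU mul1mx mul_mx_scalar -scalemxAl.
rewrite -scalemxAr uu /conf_density PE pairing_adapted //.
rewrite !mxE /= !mulr1n !mulr1.
by rewrite !expr2.
Qed.

Local Notation C := R[i].

(** [del] and [delbar] have coordinates (1, - i) / 2 and (1, i) / 2 in the frame
    (e1, e2); compare first coordinates in A del = alpha delbar. *)
Lemma given_byE A (alpha : R * R -> C) q a b : -1 <= q.2 <= 1 ->
  A (chart q) = adapted (chart q) (chart_frame q) 0 (symtf a b) ->
  cplx (A (chart q)) *m del q = alpha q *: delbar q ->
  alpha q = Complex a (- b).
Proof.
move=> q2 AE; have F := frame_chart q2; have [_ _ UU _ _] := F.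
set U := chart_frame q in F UU AE *.
have delE k : 2^-1 *: (cplx (e1 q) + k *: cplx (e2 q)) =
    cplx U *m \col_j (if j == 0 then 2^-1 else 2^-1 * k).
  apply/matrixP => i j; rewrite ord1 !mxE !big_ord_recl big_ord0 addr0 !mxE /=.
  by rewrite mulrDr mulrC; congr (_ + _); rewrite mulrA [RHS]mulrC.
have cU : cplx U^T *m cplx U = 1%:M by rewrite -map_mxM UU map_mx1.
rewrite /del /delbar -scaleNr !delE AE /adapted scale0r add0r.
rewrite /cplx !map_mxM -/(cplx _).
move=> /(congr1 (fun Z => cplx U^T *m Z)).
rewrite -scalemxAr !mulmxA cU mul1mx -!mulmxA (mulmxA _ (cplx U)) cU !mul1mx.
move=> /matrixP/(_ 0 0); rewrite !mxE !big_ord_recl big_ord0 !mxE /=.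
rewrite addr0 !mulrN [2^-1 * _]mulrC mulrA -mulrBl => /mulIf <-.
  by apply/eqP; rewrite eq_complex /=; apply/andP; split; apply/eqP; ring.
by rewrite invr_eq0 pnatr_eq0.
Qed.

Lemma chart_dom_height q : chart_dom q -> -1 <= q.2 <= 1.
Proof. by move=> [_] /=; rewrite in_itv /= => /andP[? ?]; rewrite !ltW. Qed.

Lemma sphere_chart q : -1 <= q.2 <= 1 -> sphere (chart q).
Proof. by move=> /orthonormal_chart[]. Qed.

Lemma pairing_given_by A B (alpha beta : R * R -> C) q :
  EndSJ0 A -> EndSJ0 B -> given_by A alpha -> given_by B beta -> chart_dom q ->
  [/\ pairing (A (chart q)) (A (chart q)) = normc (alpha q) ^+ 2,
      pairing (B (chart q)) (B (chart q)) = normc (beta q) ^+ 2,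
      pairing (A (chart q)) (B (chart q)) =
        complex.Re ((alpha q)^*%C * beta q) &
      complex.Im (alpha q * (beta q)^*%C) ^+ 2 =
        normc (alpha q) ^+ 2 * normc (beta q) ^+ 2 -
        complex.Re ((alpha q)^*%C * beta q) ^+ 2].
Proof.
move=> sA sB gA gB dq; have q2 := chart_dom_height dq.
have F := frame_chart q2; have xS := sphere_chart q2.
have [a [b AE]] := symm_anticomm_adapted F (EndSJ0_symm_anticomm sA xS).
have [c [d BE]] := symm_anticomm_adapted F (EndSJ0_symm_anticomm sB xS).
have [/(given_byE q2 AE) -> _] := gA _ dq.
have [/(given_byE q2 BE) -> _] := gB _ dq.
rewrite AE BE !pairing_adapted //= !sqr_sqrtr ?addr_ge0 ?sqr_ge0 //.
by split; ring.
Qed.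

End ComplexStructure.

(** * Integration over the chart *)

Section ChartIntegral.
Variable R : realType.
Implicit Types (q : R * R) (f : R * R -> R).

(** An open set of the plane is the union of the squares with rational centre
    and radius that it contains. *)
Lemma open_prod_measurable (U : set (R * R)) : open U ->
  measurable (U : set (measurableTypeR R * measurableTypeR R)).
Proof.
move=> oU.
pose B (a b r : rat) : set (R * R) :=
  ball (ratr a : R) (ratr r : R) `*` ball (ratr b : R) (ratr r : R).
have -> : U = \bigcup_a \bigcup_b \bigcup_r
    (if pselect (B a b r `<=` U) then B a b r else set0).
  apply/seteqP; split=> [[x y] Uxy|xy [a _] [b _] [r _]]; last first.
    by case: pselect => // sub /sub.
  have /nbhs_ballP[e /= e0 eU] := open_nbhs_nbhs (conj oU Uxy).
  have /rat_in_itvoo[r] : (0 : R) < e / 2 by rewrite divr_gt0.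
  rewrite in_itv /= => /andP[r0 re].
  have rr z : z - ratr r < z + ratr r :> R by lra.
  have [a] := rat_in_itvoo (rr x); rewrite in_itv /= => /andP[? ?].
  have [b] := rat_in_itvoo (rr y); rewrite in_itv /= => /andP[? ?].
  exists a => //; exists b => //; exists r => //.
  have Bxy : B a b r (x, y).
    by split; rewrite /ball /= ltr_norml; apply/andP; split; lra.
  case: pselect => // -[] [x' y'] [ax' by']; apply: eU.
  move: ax' by'; rewrite /ball /= !ltr_norml => /andP[? ?] /andP[? ?].
  by split; rewrite /ball /= ltr_norml; apply/andP; split; lra.
apply: bigcupT_measurable_rat => a /=.
apply: bigcupT_measurable_rat => b /=.
apply: bigcupT_measurable_rat => r /=.
case: pselect => [sub|nsub] /=; last exact: measurable0.
by apply: measurableX; exact: measurable_ball.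
Qed.

Lemma continuous_prod_measurable f : continuous f ->
  measurable_fun setT (f : measurableTypeR R * measurableTypeR R -> R).
Proof.
move=> /continuousP cf; apply: (measurability _ (RGenOpens.measurableE R)).
move=> _ [_ [a [b ->] <-]]; rewrite setTI; apply: open_prod_measurable.
exact/cf/interval_open.
Qed.

Local Notation mu := (@lebesgue_measure R \x @lebesgue_measure R)%E.

Lemma measurable_chart_dom :
  measurable (@chart_dom R : set (measurableTypeR R * measurableTypeR R)).
Proof. by apply: measurableX; exact: measurable_itv. Qed.

Lemma length_itvoo (a b : R) : a <= b ->
  lebesgue_measure (`]a, b[ : set R) = (b - a)%:E.
Proof.
move=> ab; rewrite lebesgue_measure_itv /= lte_fin.
case: ltP => [_|ba]; first by rewrite EFinB.
by have -> : b = a; [apply/le_anti/andP|rewrite subrr].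
Qed.

Lemma area_box (a b c d : R) : a <= b -> c <= d ->
  mu (`]a, b[ `*` `]c, d[) = ((b - a) * (d - c))%:E.
Proof.
move=> ab cd; rewrite product_measure1E; try exact: measurable_itv.
by rewrite /= !length_itvoo.
Qed.

Lemma area_chart_dom : mu (@chart_dom R) = (4 * pi)%:E.
Proof.
rewrite /chart_dom area_box; last lra.
  by congr (_%:E); ring.
by rewrite mulr_ge0 // pi_ge0.
Qed.

(** A continuous function is bounded on the closed rectangle, and the area is
    finite. *)
Lemma integrable_chart f : continuous f ->
  mu.-integrable (@chart_dom R) (EFin \o f).
Proof.
move=> cf; apply: measurable_bounded_integrable.
- exact: measurable_chart_dom.
- by have := ltry (4 * pi : R); rewrite -area_chart_dom.
- apply: measurable_funS (continuous_prod_measurable cf) => //.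
- have cK : compact (`[0, 2 * pi] `*` `[-1, 1] : set (R * R)).
    by apply: compact_setX; exact: segment_compact.
  have /(continuous_compact) := cK.
  move=> /(_ _ f) /(_ (continuous_subspaceT cf)) /compact_bounded[M [_ mrt]].
  exists M; split; rewrite ?num_real // => y My [u v] /= [uD vD].
  apply: mrt => //.
  exists (u, v) => //; split => /=.
    by move: uD; rewrite /= !in_itv /= => /andP[? ?]; rewrite !ltW.
  by move: vD; rewrite /= !in_itv /= => /andP[? ?]; rewrite !ltW.
Qed.

Lemma eq_intM f h : (forall q, chart_dom q -> f q = h q) -> intM f = intM h.
Proof. by move=> fh; apply: eq_Rintegral => q; rewrite inE => /fh. Qed.

Lemma intMZ k f : continuous f -> intM (fun q => k * f q) = k * intM f.
Proof.
move=> cf; rewrite /intM RintegralZl //; first exact: measurable_chart_dom.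
exact: integrable_chart.
Qed.

(** The point q0 may lie on the boundary of the rectangle.  A square around it
    on which f > f q0 / 2 still meets the open rectangle in a box of positive
    area. *)
Lemma intM_gt0 f q0 : continuous f -> (forall q, 0 <= f q) ->
  0 <= q0.1 <= 2 * pi -> -1 <= q0.2 <= 1 -> 0 < f q0 -> 0 < intM f.
Proof.
move=> cf f0; case: q0 => u v /= /andP[u0 u1] /andP[v0 v1] fq.
have : \forall q \near (u, v), f (u, v) / 2 < f q.
  apply: (cvgr_gt (f (u, v)) (cf (u, v))).
  by rewrite gtr_pMr // invf_lt1 ?ltr1n.
move=> /nbhs_ballP[e /= e0 ef].
have pi0 := pi_gt0 R.
pose a := Num.max 0 (u - e); pose b := Num.min (2 * pi) (u + e).
pose c := Num.max (-1) (v - e); pose d := Num.min 1 (v + e).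
have ab : a < b.
  rewrite /a /b gt_max !lt_min.
  by apply/andP; split; apply/andP; split; lra.
have cd : c < d.
  rewrite /c /d gt_max !lt_min.
  by apply/andP; split; apply/andP; split; lra.
pose D : set (measurableTypeR R * measurableTypeR R) := `]a, b[ `*` `]c, d[.
have mD : measurable D by apply: measurableX; exact: measurable_itv.
have DS : D `<=` @chart_dom R.
  move=> [s t] [] /=; rewrite !in_itv /= !gt_max !lt_min.
  move=> /andP[/andP[? ?] /andP[? ?]] /andP[/andP[? ?] /andP[? ?]].
  by split; rewrite /= in_itv /=; apply/andP.
have fD q : D q -> f (u, v) / 2 <= f q.
  case: q => s t [] /=; rewrite !in_itv /= !gt_max !lt_min.
  move=> /andP[/andP[? ?] /andP[? ?]] /andP[/andP[? ?] /andP[? ?]].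
  apply: ltW; apply: ef.
  by split; rewrite /ball /= ltr_norml; apply/andP; split; lra.
have mf : measurable_fun (@chart_dom R)
    (f : measurableTypeR R * measurableTypeR R -> R).
  exact: measurable_funS (continuous_prod_measurable cf).
have area_le : (((f (u, v) / 2) * ((b - a) * (d - c)))%:E <=
    \int[mu]_(q in D) (f q)%:E)%E.
  rewrite EFinM -(area_box (ltW ab) (ltW cd)) -integral_cst //.
  apply: ge0_le_integral => //.
  - by move=> q _; rewrite lee_fin divr_ge0 // ltW.
  - apply/measurable_EFinP; apply: measurable_funS mf => //.
    exact: measurable_chart_dom.
have sub_le : (\int[mu]_(q in D) (f q)%:E <=
    \int[mu]_(q in @chart_dom R) (f q)%:E)%E.
  apply: ge0_subset_integral => //; first exact: measurable_chart_dom.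
    exact/measurable_EFinP.
  by move=> q _; rewrite lee_fin.
have If := integrable_fin_num measurable_chart_dom (integrable_chart cf).
have := le_trans area_le sub_le; rewrite -(fineK If) lee_fin.
apply: lt_le_trans.
by rewrite mulr_gt0 ?divr_gt0 // mulr_gt0 ?subr_gt0.
Qed.

(** Cauchy-Schwarz against the constant 1: expand the integral of (f - k)^2
    where k is the mean value of f. *)
Lemma intM_sqr_le f : continuous f ->
  intM f ^+ 2 <= 4 * pi * intM (fun q => f q ^+ 2).
Proof.
move=> cf; have pi0 := pi_gt0 R.
have cf2 : continuous (fun q => f q ^+ 2).
  by move=> q; exact: (continuousM (cf q) (cf q)).
have mD := measurable_chart_dom.
set m := intM f; set I2 := intM _.
pose k := m / (4 * pi).
have : 0 <= intM (fun q => f q ^+ 2 + (- (2 * k) * f q + k ^+ 2)).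
  apply: Rintegral_ge0 => q _.
  have -> : f q ^+ 2 + (- (2 * k) * f q + k ^+ 2) = (f q - k) ^+ 2 by ring.
  exact: sqr_ge0.
have ck : continuous (fun _ : R * R => k ^+ 2) by move=> ?; exact: cvg_cst.
have ckf : continuous (fun q => - (2 * k) * f q).
  by move=> q; apply: cvgM; [exact: cvg_cst|exact: cf].
rewrite /intM RintegralD //; first last.
- apply: (@integrable_chart (fun q => - (2 * k) * f q + k ^+ 2)) => q.
  by apply: cvgD; [exact: ckf|exact: ck].
- exact: integrable_chart.
rewrite RintegralD //; try exact: integrable_chart.
rewrite -/(intM (fun q => - (2 * k) * f q)) intMZ // -/m.
rewrite -/(intM (fun q => f q ^+ 2)) -/I2.
rewrite Rintegral_cst //= area_chart_dom /=.
have -> : I2 + (- (2 * k) * m + k ^+ 2 * (4 * pi)) = I2 - m ^+ 2 / (4 * pi).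
  rewrite /k; clearbody m I2; move: (@pi R) pi0 => P P0.
  by field; rewrite gt_eqF.
rewrite subr_ge0 ler_pdivrMr ?mulr_gt0 //.
by rewrite mulrC.
Qed.

End ChartIntegral.

(** * Continuity of the integrands *)

Section ChartContinuity.
Variable R : realType.
Implicit Types (q : R * R) (f : R * R -> R) (T A B P : tfield R).

Lemma continuous_sum_I3 (F : 'I_3 -> R * R -> R) :
  (forall i, continuous (F i)) ->
  continuous (fun q => \sum_(i < 3) F i q).
Proof.
move=> cF.
have -> : (fun q => \sum_(i < 3) F i q) = (fun q => F 0 q + F 1 q + F 2%:R q).
  by apply/funext => q; rewrite sum_I3.
by move=> q; apply: cvgD; [apply: cvgD|]; exact: cF.
Qed.

Lemma continuous_col (F : R * R -> 'cV[R]_3) :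
  (forall i, continuous (fun q => F q i 0)) ->
  continuous F.
Proof.
move=> cF q; apply/cvg_ballP => e e0.
have near_i i : \forall q' \near q, ball (F q i 0) e (F q' i 0).
  by have /cvg_ballP/(_ e e0) := cF i q.
have near_all := filter_forall _ near_i.
near=> q'; split => // i j; rewrite ord1; move: i.
by near: q'; exact: near_all.
Unshelve. all: by end_near.
Qed.

Lemma continuous_chart : continuous (@chart R).
Proof.
have c1 : continuous (fun q => q.1) by move=> q; exact: cvg_fst.
have c2 : continuous (fun q => q.2) by move=> q; exact: cvg_snd.
have cr : continuous (fun q => Num.sqrt (1 - q.2 ^+ 2)).
  move=> q.
  apply: (@continuous_comp _ _ _ (fun q => 1 - q.2 ^+ 2) (@Num.sqrt R));
    last exact: sqrt_continuous.
  by apply: cvgB; [exact: cvg_cst|exact: (cvgM (c2 q) (c2 q))].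
have cc : continuous (fun q => cos q.1).
  by move=> q; apply: (continuous_comp (c1 q)); exact: continuous_cos.
have cs : continuous (fun q => sin q.1).
  by move=> q; apply: (continuous_comp (c1 q)); exact: continuous_sin.
apply: continuous_col; apply: all_I3.
- have -> : (fun q => chart q 0 0) =
      (fun q => Num.sqrt (1 - q.2 ^+ 2) * cos q.1).
    by apply/funext => q; rewrite mxE.
  by move=> q; exact: (cvgM (cr q) (cc q)).
- have -> : (fun q => chart q 1 0) =
      (fun q => Num.sqrt (1 - q.2 ^+ 2) * sin q.1).
    by apply/funext => q; rewrite mxE.
  by move=> q; exact: (cvgM (cr q) (cs q)).
- have -> : (fun q => chart q 2%:R 0) = (fun q => q.2); last exact: c2.
  by apply/funext => q; rewrite mxE.
Qed.

Lemma dot_chart_gt0 q : 0 < dot (chart q) (chart q).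
Proof.
rewrite /dot sum_I3 !mxE /=.
set r := Num.sqrt _.
have -> : r * cos q.1 * (r * cos q.1) + r * sin q.1 * (r * sin q.1) +
    q.2 * q.2 = r ^+ 2 + q.2 ^+ 2.
  have := cos2Dsin2 q.1; move: (cos _) (sin _) => c s cs.
  by rewrite -[r ^+ 2]mulr1 -cs; ring.
have [z1|z1] := leP (q.2 ^+ 2) 1.
  by rewrite sqr_sqrtr ?subr_ge0 //; lra.
by rewrite ltr_wpDl ?sqr_ge0 // (lt_trans ltr01).
Qed.

(** Smoothness of a field is smoothness of its extension along rays, so fields
    are evaluated at the normalized chart.  It agrees with the chart for
    |z| <= 1, where the square root is the intended one, and it stays on the
    sphere, at a pole, for |z| > 1. *)
Definition chart_ray q : 'cV[R]_3 := radial (chart q).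

Lemma sphere_chart_ray q : sphere (chart_ray q).
Proof.
have d0 := dot_chart_gt0 q.
rewrite /sphere /= /chart_ray /radial; set k := _^-1.
have -> : dot (k *: chart q) (k *: chart q) = k ^+ 2 * dot (chart q) (chart q).
  by rewrite /dot mulr_sumr; apply: eq_bigr => i _; rewrite !mxE; ring.
by rewrite /k exprVn sqr_sqrtr ?ltW // mulVf // gt_eqF.
Qed.

Lemma chart_rayE q : -1 <= q.2 <= 1 -> chart_ray q = chart q.
Proof.
by move=> /sphere_chart xx; rewrite /chart_ray /radial xx sqrtr1 invr1 scale1r.
Qed.

Lemma continuous_field T i j : smooth_field T ->
  continuous (fun q => T (chart_ray q) i j).
Proof.
move=> sT q; have [/= cT _] := sT i j 0%N.
apply: (@continuous_comp _ _ _ (@chart R) (fun x => T (radial x) i j)).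
  exact: continuous_chart.
apply: cT => /=; apply/eqP => c0; have := dot_chart_gt0 q.
by rewrite c0 /dot big1 ?ltxx // => k _; rewrite mxE mul0r.
Qed.

Lemma continuous_pairing A B : smooth_field A -> smooth_field B ->
  continuous (fun q => pairing (A (chart_ray q)) (B (chart_ray q))).
Proof.
move=> sA sB q; apply: cvgM; first exact: cvg_cst.
apply: (@continuous_sum_I3
  (fun i q => (A (chart_ray q) *m B (chart_ray q)) i i)) => i.
have -> : (fun q => (A (chart_ray q) *m B (chart_ray q)) i i) =
  (fun q => \sum_(j < 3) A (chart_ray q) i j * B (chart_ray q) j i).
  by apply/funext => q'; rewrite mxE.
apply: continuous_sum_I3 => j q'.
have cA := @continuous_field A i j sA; have cB := @continuous_field B j i sB.
exact: (cvgM (cA q') (cB q')).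
Qed.

(** Re (conj alpha * beta) / (1 - |p|^2)^2. *)
Definition weight P A B q : R :=
  pairing (A (chart_ray q)) (B (chart_ray q)) /
  conf_density P (chart_ray q) ^+ 2.

Lemma continuous_weight P A B : EndSJ0 P -> subunit P -> EndSJ0 A -> EndSJ0 B ->
  continuous (weight P A B).
Proof.
move=> sP uP sA sB q.
have smooth (M : tfield R) : EndSJ0 M -> smooth_field M by case=> -[].
have cd : continuous (fun q => conf_density P (chart_ray q)).
  move=> q'; apply: cvgB; first exact: cvg_cst.
  exact: (continuous_pairing (smooth _ sP) (smooth _ sP)).
have cp := continuous_pairing (smooth _ sA) (smooth _ sB).
apply: cvgM; first exact: cp.
apply: cvgV; last exact: (cvgM (cd q) (cd q)).
by rewrite expf_neq0 // gt_eqF // conf_density_gt0 //; exact: sphere_chart_ray.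
Qed.

End ChartContinuity.

(** * Sectional curvature *)

Section SectionalCurvature.
Variable R : realType.
Implicit Types (q : R * R) (f : R * R -> R) (T A B P g J a b : tfield R).

Lemma inner_intM g a b f : continuous f ->
  (forall q, chart_dom q ->
     \tr (raise g a (chart q) *m raise g b (chart q)) = 8 * f q) ->
  inner g a b = 8 * intM f.
Proof. by move=> cf fE; rewrite /inner (eq_intM fE) intMZ. Qed.

(** Constants: 8^2 * 4 = 256 from the denominator against 128.  When the wedge
    product vanishes both sides are 0. *)
Lemma sectional_intM g a b (faa fbb fab : R * R -> R) :
  continuous faa -> continuous fbb -> continuous fab ->
  (forall q, chart_dom q -> let A := raise g a (chart q) in
     let B := raise g b (chart q) in
     [/\ \tr (A *m A) = 8 * faa q, \tr (B *m B) = 8 * fbb q,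
         \tr (A *m B) = 8 * fab q &
         \tr (commutator A B *m commutator A B) =
           - 128 * (faa q * fbb q - fab q ^+ 2)]) ->
  sectional g a b = - (1 / 2) *
    (intM (fun q => faa q * fbb q - fab q ^+ 2) /
      (intM faa * intM fbb - intM fab ^+ 2)).
Proof.
move=> ca cb cab E.
have cN : continuous (fun q => faa q * fbb q - fab q ^+ 2).
  move=> q; apply: cvgB; first exact: (cvgM (ca q) (cb q)).
  exact: (cvgM (cab q) (cab q)).
have Iaa := @inner_intM g a a _ ca
  (fun q dq => let: And4 h _ _ _ := E q dq in h).
have Ibb := @inner_intM g b b _ cb
  (fun q dq => let: And4 _ h _ _ := E q dq in h).
have Iab := @inner_intM g a b _ cab
  (fun q dq => let: And4 _ _ h _ := E q dq in h).
have IN : intM (fun q =>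
    let C := commutator (raise g a (chart q)) (raise g b (chart q)) in
    \tr (C *m C)) = - 128 * intM (fun q => faa q * fbb q - fab q ^+ 2).
  by rewrite -intMZ //; apply: eq_intM => q /E[].
rewrite /sectional IN /wedge2 Iaa Ibb Iab.
move: (intM faa) (intM fbb) (intM fab) (intM (fun q => _ - _)) => x y z N.
have -> : 4 * (8 * x * (8 * y) - (8 * z) ^+ 2) = 256 * (x * y - z ^+ 2) by ring.
by rewrite invfM; move: (x * y - z ^+ 2)^-1 => D; field.
Qed.

Variables (g J P : tfield R).
Hypotheses (gJ : associated_metric g J) (sP : EndSJ0 P) (uP : subunit P)
  (gP : forall x, sphere x -> g x = metric_of P x).

Lemma weightE A B q : chart_dom q -> weight P A B q =
  pairing (A (chart q)) (B (chart q)) / conf_density P (chart q) ^+ 2.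
Proof. by move=> /chart_dom_height q2; rewrite /weight chart_rayE. Qed.

Lemma traces_chart A B q : symm_anticomm (chart q) (A (chart q)) ->
  symm_anticomm (chart q) (B (chart q)) -> chart_dom q ->
  let a := raise g (h_of P A) (chart q) in
  let b := raise g (h_of P B) (chart q) in
  [/\ \tr (a *m a) = 8 * weight P A A q, \tr (b *m b) = 8 * weight P B B q,
      \tr (a *m b) = 8 * weight P A B q &
      \tr (commutator a b *m commutator a b) = - 128 *
        (weight P A A q * weight P B B q - weight P A B q ^+ 2)].
Proof.
move=> sA sB dq /=; have q2 := chart_dom_height dq.
have xS := sphere_chart q2; have F := frame_chart q2.
have d0 : conf_density P (chart q) != 0 by rewrite gt_eqF // conf_density_gt0.
have sPx := EndSJ0_symm_anticomm sP xS; have gx := gP xS.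
rewrite !weightE // !(mxtrace_raise F) // (mxtrace_commutator F) //.
by split=> //; field.
Qed.

Lemma sectional_h_of A B : EndSJ0 A -> EndSJ0 B ->
  sectional g (h_of P A) (h_of P B) = - (1 / 2) *
    (intM (fun q => weight P A A q * weight P B B q - weight P A B q ^+ 2) /
      (intM (weight P A A) * intM (weight P B B) - intM (weight P A B) ^+ 2)).
Proof.
move=> sA sB; apply: sectional_intM; try exact: continuous_weight.
move=> q dq; have xS := sphere_chart (chart_dom_height dq).
by apply: traces_chart => //; apply: EndSJ0_symm_anticomm.
Qed.

(** The plane is spanned by h_A and h_B with B = A J0, whose weights are w, w
    and 0. *)
Lemma holomorphic_sectional_h_of A : EndSJ0 A ->
  sectional g (h_of P A) (bfJ J (h_of P A)) = - (1 / 2) *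
    (intM (fun q => weight P A A q ^+ 2) / intM (weight P A A) ^+ 2).
Proof.
move=> sA; have cw := continuous_weight sP uP sA sA.
have c0 : continuous (fun _ : R * R => 0 : R) by move=> ?; exact: cvg_cst.
rewrite (sectional_intM cw cw c0) => [|q dq].
  have -> : intM (fun _ : R * R => 0 : R) = 0.
    by rewrite /intM Rintegral_cst ?mul0r //; exact: measurable_chart_dom.
  rewrite expr0n /= subr0 -expr2; congr (_ * (_ / _)).
  by apply: eq_intM => q _; rewrite subr0 expr2.
have xS := sphere_chart (chart_dom_height dq).
have sAx := EndSJ0_symm_anticomm sA xS.
have d0 : conf_density P (chart q) != 0 by rewrite gt_eqF // conf_density_gt0.
have hJ := h_of_mulJ0 gJ xS (EndSJ0_symm_anticomm sP xS) sAx (gP xS) d0.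
have -> : raise g (bfJ J (h_of P A)) (chart q) =
    raise g (h_of P (mulJ0 A)) (chart q).
  by rewrite /raise hJ.
have := traces_chart sAx (symm_anticomm_mulJ0 sAx) dq.
have [pJ p0] := pairing_mulJ0 xS sAx.
by rewrite /= !weightE // pJ p0 mul0r.
Qed.

Lemma pairing_ge0 A x : EndSJ0 A -> sphere x -> 0 <= pairing (A x) (A x).
Proof.
move=> sA xS; have [U F] := frame_exists xS.
have [a [b ->]] := symm_anticomm_adapted F (EndSJ0_symm_anticomm sA xS).
by rewrite pairing_adapted // -!expr2 addr_ge0 ?sqr_ge0.
Qed.

Lemma pairing_eq0 A x : EndSJ0 A -> sphere x ->
  pairing (A x) (A x) = 0 -> A x = 0.
Proof.
move=> sA xS; have [U F] := frame_exists xS.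
have [a [b ->]] := symm_anticomm_adapted F (EndSJ0_symm_anticomm sA xS).
rewrite pairing_adapted // -!expr2 => /eqP.
rewrite paddr_eq0 ?sqr_ge0 // !sqrf_eq0 => /andP[/eqP -> /eqP ->].
rewrite /adapted scale0r add0r.
have -> : symtf 0 0 = 0 :> 'M[R]_2.
  by apply/matrixP => i j; rewrite !mxE oppr0 !if_same.
by rewrite mulmx0 mul0mx.
Qed.

Lemma intM_weight_gt0 A : EndSJ0 A -> ~ (forall x, sphere x -> A x = 0) ->
  0 < intM (weight P A A).
Proof.
move=> sA A0.
have [x [xS Ax]] : exists x, sphere x /\ A x <> 0.
  apply: contra_notP A0 => nA x xS; apply: contrapT => Ax; apply: nA.
  by exists x.
have [q0 [q1 q2] xE] := chart_surj xS.
have rS := sphere_chart_ray.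
apply: (@intM_gt0 _ _ q0) => //.
- exact: continuous_weight.
- by move=> q; rewrite divr_ge0 ?pairing_ge0 ?sqr_ge0.
rewrite /weight chart_rayE // -xE divr_gt0 //.
  rewrite lt_neqAle pairing_ge0 // andbT eq_sym.
  by apply/eqP => /(pairing_eq0 sA xS).
by rewrite exprn_gt0 // conf_density_gt0.
Qed.

End SectionalCurvature.

Theorem theorem8p1 (R : realType) (g J P : tfield R) (p : R * R -> R[i]) :
  associated_metric g J ->
  EndSJ0 P -> subunit P -> given_by P p ->
  (forall x, sphere x -> g x = metric_of P x) ->
  (forall (A B : tfield R) (alpha beta : R * R -> R[i]),
     EndSJ0 A -> EndSJ0 B -> given_by A alpha -> given_by B beta ->
     lin_indep (h_of P A) (h_of P B) ->
     [/\ sectional g (h_of P A) (h_of P B) =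
           - (1 / 2) *
           (intM (fun q => complex.Im (alpha q * (beta q)^*%C) ^+ 2
                           / (1 - normc (p q) ^+ 2) ^+ 4)
            / (intM (fun q => normc (alpha q) ^+ 2
                              / (1 - normc (p q) ^+ 2) ^+ 2)
               * intM (fun q => normc (beta q) ^+ 2
                                / (1 - normc (p q) ^+ 2) ^+ 2)
               - intM (fun q => complex.Re ((alpha q)^*%C * beta q)
                                / (1 - normc (p q) ^+ 2) ^+ 2) ^+ 2)),
         (real_on_dom alpha /\ real_on_dom beta) \/
         (imag_on_dom alpha /\ imag_on_dom beta) ->
         sectional g (h_of P A) (h_of P B) = 0 &
         (real_on_dom alpha /\ imag_on_dom beta) \/
         (imag_on_dom alpha /\ real_on_dom beta) ->
         sectional g (h_of P A) (h_of P B) =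
           - (1 / 2) *
           (intM (fun q => complex.Im (alpha q * beta q) ^+ 2
                           / (1 - normc (p q) ^+ 2) ^+ 4)
            / (intM (fun q => normc (alpha q) ^+ 2
                              / (1 - normc (p q) ^+ 2) ^+ 2)
               * intM (fun q => normc (beta q) ^+ 2
                                / (1 - normc (p q) ^+ 2) ^+ 2)))]) /\
  (forall A : tfield R,
     EndSJ0 A -> ~ (forall x, sphere x -> A x = 0) ->
     sectional g (h_of P A) (bfJ J (h_of P A)) <= - (1 / (8 * pi))).
Proof.
move=> gJ sP uP gp gP; split=> [A B alpha beta sA sB gA gB _|A sA A0].
  have dens q : chart_dom q -> conf_density P (chart q) = 1 - normc (p q) ^+ 2.
    move=> dq; have [pE _ _ _] := pairing_given_by sP sP gp gp dq.
    by rewrite /conf_density pE.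
  have IA : intM (weight P A A) =
      intM (fun q => normc (alpha q) ^+ 2 / (1 - normc (p q) ^+ 2) ^+ 2).
    apply: eq_intM => q dq; rewrite weightE // dens //.
    by have [-> _ _ _] := pairing_given_by sA sB gA gB dq.
  have IB : intM (weight P B B) =
      intM (fun q => normc (beta q) ^+ 2 / (1 - normc (p q) ^+ 2) ^+ 2).
    apply: eq_intM => q dq; rewrite weightE // dens //.
    by have [_ -> _ _] := pairing_given_by sA sB gA gB dq.
  have IAB : intM (weight P A B) =
      intM (fun q => complex.Re ((alpha q)^*%C * beta q) /
                     (1 - normc (p q) ^+ 2) ^+ 2).
    apply: eq_intM => q dq; rewrite weightE // dens //.
    by have [_ _ -> _] := pairing_given_by sA sB gA gB dq.
  have IN : intM (fun q =>
        weight P A A q * weight P B B q - weight P A B q ^+ 2) =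
      intM (fun q => complex.Im (alpha q * (beta q)^*%C) ^+ 2 /
                     (1 - normc (p q) ^+ 2) ^+ 4).
    apply: eq_intM => q dq.
    have [EA EB EAB ->] := pairing_given_by sA sB gA gB dq.
    have d0 : 1 - normc (p q) ^+ 2 != 0.
      rewrite -dens // gt_eqF // conf_density_gt0 //.
      exact/sphere_chart/chart_dom_height.
    by rewrite !weightE // EA EB EAB dens //; field.
  have main := sectional_h_of sP uP gP sA sB.
  rewrite IA IB IAB IN in main.
  have intM0 (h : R * R -> R) :
      (forall q, chart_dom q -> h q = 0) -> intM h = 0.
    move=> h0; rewrite (eq_intM h0) /intM Rintegral_cst ?mul0r //.
    exact: measurable_chart_dom.
  split=> // cases; rewrite main.
    rewrite (intM0 (fun q => _ / _)) ?mul0r ?mulr0 // => q dq.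
    have -> : complex.Im (alpha q * (beta q)^*%C) = 0.
      by case: cases => -[/(_ q dq) + /(_ q dq)];
      case: (alpha q) (beta q) => a b [c d] /= -> ->; ring.
    by rewrite expr0n mul0r.
  have -> : intM (fun q => complex.Re ((alpha q)^*%C * beta q) /
                           (1 - normc (p q) ^+ 2) ^+ 2) = 0.
    apply: intM0 => q dq.
    have -> : complex.Re ((alpha q)^*%C * beta q) = 0.
      by case: cases => -[/(_ q dq) + /(_ q dq)];
      case: (alpha q) (beta q) => a b [c d] /= -> ->; ring.
    by rewrite mul0r.
  rewrite expr0n subr0; congr (_ * (_ / _)).
  apply: eq_intM => q dq; congr (_ / _).
  by case: cases => -[/(_ q dq) + /(_ q dq)];
    case: (alpha q) (beta q) => a b [c d] /= -> ->; ring.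
rewrite (holomorphic_sectional_h_of gJ sP uP gP sA).
have I0 := intM_weight_gt0 sP uP sA A0.
have := intM_sqr_le (continuous_weight sP uP sA sA).
move: (intM (weight P A A)) I0 => I I0.
move: (intM (fun q => _ ^+ 2)) => I2.
move: (@pi R) (pi_gt0 R) => c c0 I2ge.
rewrite mulNr lerN2 mulf_div !mul1r ler_pdivlMr ?mulr_gt0 ?exprn_gt0 //.
by rewrite mulrC ler_pdivrMr ?mulr_gt0 //; lra.
Qed.
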